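(* Let $f:\mathbb{R}^m\to(-\infty,\infty]$ be proper, lower semicontinuous and bounded from below. Let $\psi,\beta:\mathbb{R}_+\to\mathbb{R}_+$ be increasing admissible functions, let $\{(x_k,e_k)\}\subset\mathbb{R}^m\times\mathbb{R}_+$ be a sequence satisfying conditions (H0), (H1), (H2), (H3) listed in the context (with this $\beta$ and a constant $b>0$ in (H2)), let $\Omega$ be the set of accumulation points of $\{x_k\}$, and let $\overline{x}\in\Omega$. Let $\Gamma=\{x:0\in\partial f(x)\}$. Fix any closed set $\Xi$ with $\Omega\subset\Xi\subset\Gamma$, and assume that $\mathcal{L}(f(x_{k_0}))=\{y: f(y)\le f(x_{k_0})\}$ is bounded for some $k_0\in\mathbb{N}$ and that the following hold: (i) There exist $\gamma,\eta\in(0,\infty)$ such that $\psi(d(x,\Xi))\le\gamma\,d(0,\partial f(x))$ for all $x$ with $\|x-\overline{x}\|<\eta$. (ii) There exist $\ell>0$ and $k_1\in\mathbb{N}$ such that $e_k\le\ell\,d(x_k,\Xi)$ for all $k\ge k_1$. (iii) $\limsup_{t\to0^+}\frac{\tau(t)}{t}<1$, where $\tau:\mathbb{R}_+\to\mathbb{R}_+$ is given by $\tau(t):=\psi^{-1}(\gamma b\,\beta(\ell t))$ for all $t\in\mathbb{R}_+$. Then the sequence $\{x_k\}$ converges to $\overline{x}\in\Xi$ as $k\to\infty$ with the rate $\|x_k-\overline{x}\|=O(\tau(\|x_{k-1}-\overline{x}\|))$, i.e., $$\limsup_{k\to\infty}\frac{\|x_k-\overline{x}\|}{\tau(\|x_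{k-1}-\overline{x}\|)}<\infty.$$
   Context: $\mathbb{R}_+=[0,\infty)$, $\mathbb{N}=\{0,1,\ldots\}$; $d(x,S)$ is the Euclidean distance from $x$ to the set $S$, with $d(x,\emptyset)=\infty$. The (limiting, Mordukhovich) subdifferential $\partial f(\overline x)$ at $\overline x\in\mathrm{dom} f$ is the set of $v\in\mathbb{R}^m$ for which there exist $x_k\to\overline x$ with $f(x_k)\to f(\overline x)$ and $v_k\to v$ such that $\liminf_{x\to x_k}\frac{f(x)-f(x_k)-\langle v_k,x-x_k\rangle}{\|x-x_k\|}\ge0$ for all $k$; $\partial f(x)=\emptyset$ if $f(x)=\infty$. A function $\varphi:\mathbb{R}_+\to\mathbb{R}_+$ is admissible if $\varphi(0)=0$ and $\varphi(t)\to0$ implies $t\to0$. Conditions on $\{(x_k,e_k)\}$: (H0) $f(x_{k+1})\le f(x_k)$ for all $k\in\mathbb{N}$. (H1) There exists $c>0$ such that $\|x_{k+1}-x_k\|\le c\,e_k$ for all $k\in\mathbb{N}$, and $\lim_{k\to\infty}e_k=0$. (H2) For all $k\in\mathbb{N}$ there exists $w_{k+1}\in\partial f(x_{k+1})$ such that $\|w_{k+1}\|\le b\,\beta(e_k)$, where $b>0$ is a fixed constant. (H3) For each subsequence $\{x_{k_j}\}$ with $\lim_{j\to\infty}x_{k_j}=\widetilde x$, one has $\limsup_{j\to\infty}f(x_{k_j})\le f(\widetilde x)$. *)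

(* Defs.v *)
From HB Require Import structures.
From mathcomp Require Import all_boot all_order all_algebra.
From mathcomp Require Import all_classical all_reals all_analysis.
Set Implicit Arguments.
Unset Strict Implicit.
Unset Printing Implicit Defensive.
Import Order.TTheory GRing.Theory Num.Theory.
Import numFieldNormedType.Exports.
Local Open Scope classical_set_scope.
Local Open Scope ring_scope.

Section euclidean.
Context {R : realType} {m : nat}.
Implicit Types (x y : 'rV[R]_m) (S : set 'rV[R]_m).

Definition dotp x y : R := \sum_(i < m) x 0 i * y 0 i.

(* The library norm `|x| on 'rV[R]_m is the sup norm; it induces the same
   topology and the same bounded sets as the Euclidean norm. *)
Definition enorm x : R := Num.sqrt (dotp x x).

(* The infimum over the empty set is +oo. *)
Definition edist_to x S : \bar R := ereal_inf [set (enorm (x - y))%:E | y in S].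

End euclidean.

Section subdifferential.
Context {R : realType} {m : nat}.
Local Open Scope ereal_scope.
Implicit Types (f : 'rV[R]_m -> \bar R) (x v : 'rV[R]_m).

Definition proper_fun f :=
  (forall x, -oo < f x) /\ (exists x, f x < +oo).

Definition bounded_below f := exists M : R, forall x, M%:E <= f x.

Definition sublevel f (a : \bar R) : set 'rV[R]_m := [set y | f y <= a].

(* Finiteness of f x keeps f y - f x from being the meaningless +oo - +oo.
   The liminf is taken over the punctured neighborhoods of x. *)
Definition regular_subdiff f x : set 'rV[R]_m :=
  [set v | f x \is a fin_num /\
    0 <= limf_einf (fun y => (f y - f x - (dotp v (y - x))%:E)
                             * ((enorm (y - x))^-1)%:E) x^'].

Definition limiting_subdiff f x : set 'rV[R]_m :=
  [set v | f x < +oo /\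
    exists (u w : nat -> 'rV[R]_m),
      [/\ u @ \oo --> x, f \o u @ \oo --> f x, w @ \oo --> v &
          forall k, regular_subdiff f (u k) (w k)]].

Definition critical_set f : set 'rV[R]_m := [set x | limiting_subdiff f x 0%R].

End subdifferential.

Section admissible.
Context {R : realType}.
Implicit Types phi psi beta : R -> R.

(* Functions on [0, +oo[ are represented by functions on R whose values at
   negative arguments are irrelevant. *)
Definition admissible phi :=
  [/\ forall t, 0 <= t -> 0 <= phi t,
      phi 0 = 0 &
      forall t : nat -> R, (forall k, 0 <= t k) ->
        phi \o t @ \oo --> 0 -> t @ \oo --> 0].

Definition increasing_nneg phi := forall s t, 0 <= s -> s < t -> phi s < phi t.

Definition nneg : set R := [set t | 0 <= t].

Definition inv_nneg psi : R -> R := 'pinv_(fun=> 0) nneg psi.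

Definition rate_fun psi beta (gamma b l t : R) : R :=
  inv_nneg psi (gamma * b * beta (l * t)).

(* The inverse of psi is only defined on its range, which need not be all of
   [0, +oo[: rate_fun is a genuine map of [0, +oo[ only under this condition. *)
Definition rate_fun_defined psi beta (gamma b l : R) :=
  forall t, 0 <= t -> (psi @` nneg) (gamma * b * beta (l * t)).

End admissible.

Section sequence_conditions.
Context {R : realType} {m : nat}.
Implicit Types (f : 'rV[R]_m -> \bar R) (x : nat -> 'rV[R]_m) (e : nat -> R).

Definition condH0 f x := forall k, (f (x k.+1) <= f (x k))%E.

Definition condH1 x e :=
  (exists2 c : R, 0 < c & forall k, enorm (x k.+1 - x k) <= c * e k) /\
  e @ \oo --> 0.

Definition condH2 f x e (beta : R -> R) (b : R) := forall k,
  exists2 w, limiting_subdiff f (x k.+1) w & enorm w <= b * beta (e k).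

Definition condH3 f x := forall (s : nat -> nat) (xt : 'rV[R]_m),
  {homo s : i j / (i < j)%N} -> x \o s @ \oo --> xt ->
  (limn_esup (f \o x \o s) <= f xt)%E.

End sequence_conditions.

(* Main.v *)
Require Import Defs.
From HB Require Import structures.
From mathcomp Require Import all_boot all_order all_algebra.
From mathcomp Require Import all_classical all_reals all_analysis.
From mathcomp Require Import lra ring.
Import Order.TTheory GRing.Theory Num.Theory.
Import numFieldNormedType.Exports.
Local Open Scope classical_set_scope.
Local Open Scope ring_scope.

(** The proof follows D k := d(x_k, Xi) rather than the distance to xbar.
As soon as x_(k+1) lies in the ball of radius eta around xbar, the error bound
(i), the subgradient bound (H2) and (ii) give
  psi (D (k+1)) <= gamma d(0, subdiff f (x_(k+1))) <= gamma b beta (e_k)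
                <= gamma b beta (l D k),
that is D (k+1) <= tau (D k) ([le_rate_fun]).  By (iii) there is r < 1 with
tau t <= r t for small t, so D contracts by the factor r while the sequence
stays near xbar.  The steps are controlled by D as well:
|x_(k+1) - x_k| <= c e_k <= c l D k.

With A := c l / (1 - r), contraction and step bound together say that
|x_n - x_K| + A D n does not increase with n, hence |x_n - x_K| <= A D K
([trapped_tail]).  If x_K is close enough to xbar this also keeps x_n in the
ball where the contraction is valid, so the argument sustains itself; such K
exist because xbar is an accumulation point.  As D K <= |x_K - xbar|, all
later iterates remain within a fixed multiple of |x_K - xbar| from xbar, and
the whole sequence converges ([linear_descent_cvg]).

Letting n tend to infinity in |x_n - x_K| <= A D K gives
|x_K - xbar| <= A D K for all large K ([linear_descent_rate]).  Taking
K = k + 1 and using that tau is monotone,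
  |x_(k+1) - xbar| <= A D (k+1) <= A tau (D k) <= A tau (|x_k - xbar|). *)

(** * The Euclidean norm on row vectors *)

Section euclidean_norm.
Set Implicit Arguments.
Unset Strict Implicit.
Context {R : realType} {m : nat}.
Implicit Types (a y z : 'rV[R]_m) (S : set 'rV[R]_m).

Lemma dotp_ge0 y : 0 <= dotp y y.
Proof. by apply: sumr_ge0 => i _; exact: sqr_ge0. Qed.

Lemma enorm_ge0 y : 0 <= enorm y.
Proof. exact: sqrtr_ge0. Qed.

Lemma enorm_sqr y : enorm y ^+ 2 = dotp y y.
Proof. by rewrite sqr_sqrtr // dotp_ge0. Qed.

Lemma enormN y : enorm (- y) = enorm y.
Proof. by congr Num.sqrt; apply: eq_bigr => i _; rewrite mxE mulrNN. Qed.

Lemma enorm_distC y z : enorm (y - z) = enorm (z - y).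
Proof. by rewrite -enormN opprB. Qed.

Lemma ler_coord_norm y i : `|y 0 i| <= `|y|.
Proof.
rewrite [leRHS]/Num.norm /= mx_normrE.
exact: (le_bigmax _ (fun ij : 'I_1 * 'I_m => `|y ij.1 ij.2|) (0, i)).
Qed.

Lemma ler_norm_enorm y : `|y| <= enorm y.
Proof.
rewrite [leLHS]/Num.norm /= mx_normrE; apply: bigmax_le => [|[i j] _ /=].
  exact: enorm_ge0.
rewrite ord1 -(ler_pXn2r (n := 2)) ?nnegrE ?enorm_ge0 //.
rewrite enorm_sqr real_normK ?num_real //.
rewrite /dotp (bigD1 j) //= -expr2 lerDl.
by apply: sumr_ge0 => k _; exact: sqr_ge0.
Qed.

Lemma ler_enorm_norm y : enorm y <= Num.sqrt m%:R * `|y|.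
Proof.
rewrite -(ler_pXn2r (n := 2)) ?nnegrE ?enorm_ge0 ?mulr_ge0 ?sqrtr_ge0 //.
rewrite enorm_sqr exprMn sqr_sqrtr // mulr_natl.
have -> : `|y| ^+ 2 *+ m = \sum_(i < m) `|y| ^+ 2.
  by rewrite sumr_const card_ord.
apply: ler_sum => i _; rewrite -expr2 -real_normK ?num_real //.
by rewrite ler_pXn2r ?nnegrE // ler_coord_norm.
Qed.

Lemma enorm_eq0 y : enorm y = 0 -> y = 0.
Proof. by move=> y0; apply/eqP; rewrite -normr_le0 -y0 ler_norm_enorm. Qed.

Lemma enorm0 : enorm (0 : 'rV[R]_m) = 0.
Proof. by rewrite /enorm /dotp big1 ?sqrtr0 // => i _; rewrite mxE mulr0. Qed.

Lemma dotp_linear2 (s t : R) y z :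
  dotp (s *: y + t *: z) (s *: y + t *: z) =
  s ^+ 2 * dotp y y + (s * t *+ 2) * dotp y z + t ^+ 2 * dotp z z.
Proof.
rewrite /dotp !mulr_sumr -!big_split /=; apply: eq_bigr => i _.
by rewrite !mxE; ring.
Qed.

(** Expanding the square of [enorm z *: y - enorm y *: z] leaves, up to the
factor [2 * enorm y * enorm z], the gap in the inequality. *)
Lemma Cauchy_Schwarz_dotp y z : dotp y z <= enorm y * enorm z.
Proof.
have [y0|y0] := eqVneq (enorm y) 0.
  rewrite y0 mul0r (enorm_eq0 y0) /dotp big1 // => i _.
  by rewrite mxE mul0r.
have [z0|z0] := eqVneq (enorm z) 0.
  rewrite z0 mulr0 (enorm_eq0 z0) /dotp big1 // => i _.
  by rewrite mxE mulr0.
have := dotp_ge0 (enorm z *: y + (- enorm y) *: z).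
rewrite dotp_linear2 -!enorm_sqr.
have -> : enorm z ^+ 2 * enorm y ^+ 2 + enorm z * - enorm y *+ 2 * dotp y z +
    (- enorm y) ^+ 2 * enorm z ^+ 2 =
  (enorm y * enorm z *+ 2) * (enorm y * enorm z - dotp y z) by ring.
rewrite pmulr_rge0 ?subr_ge0 // pmulrn_lgt0 //.
by rewrite mulr_gt0 // lt0r ?y0 ?z0 enorm_ge0.
Qed.

Lemma ler_enormD y z : enorm (y + z) <= enorm y + enorm z.
Proof.
rewrite -(ler_pXn2r (n := 2)) ?nnegrE ?addr_ge0 ?enorm_ge0 //.
rewrite enorm_sqr -[y in leLHS]scale1r -[z in leLHS]scale1r dotp_linear2.
rewrite sqrrD -!enorm_sqr.
have := Cauchy_Schwarz_dotp y z; lra.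
Qed.

Lemma ler_enorm_dist a y z : enorm (y - z) <= enorm (y - a) + enorm (a - z).
Proof. by apply: le_trans (ler_enormD _ _); rewrite subrKA. Qed.

Lemma nbhs_enorm_ball a (eps : R) : 0 < eps ->
  \forall y \near a, enorm (y - a) < eps.
Proof.
move=> eps0; have M0 : 0 < Num.sqrt (m%:R : R) + 1.
  by rewrite ltr_wpDl ?sqrtr_ge0.
near=> y; apply: le_lt_trans (ler_enorm_norm _) _.
apply: (@le_lt_trans _ _ ((Num.sqrt m%:R + 1) * `|y - a|)).
  by rewrite ler_wpM2r // lerDl.
rewrite -ltr_pdivlMl // distrC mulrC.
by near: y; apply: cvgr_dist_lt => //; exact: divr_gt0.
Unshelve. all: by end_near. Qed.

Lemma cvg_enorm (T : Type) (F : set_system T) (u : T -> 'rV[R]_m) a :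
  Filter F ->
  (forall eps : R, 0 < eps -> \forall t \near F, enorm (u t - a) < eps) ->
  u @ F --> a.
Proof.
move=> FF ua; apply/cvgrPdist_lt => eps eps0; near=> t.
rewrite distrC; apply: le_lt_trans (ler_norm_enorm _) _.
by near: t; exact: ua.
Unshelve. all: by end_near. Qed.

Lemma edist_to_ge0 y S : (0 <= edist_to y S)%E.
Proof. by apply: le_ereal_inf_tmp => _ [z _ <-]; rewrite lee_fin enorm_ge0. Qed.

Lemma edist_to_le y S z : S z -> (edist_to y S <= (enorm (y - z))%:E)%E.
Proof. by move=> Sz; apply: ereal_inf_lbound; exists z. Qed.

Lemma edist_to_fin_num y S z : S z -> edist_to y S \is a fin_num.
Proof.
move=> Sz; rewrite ge0_fin_numE ?edist_to_ge0 //.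
exact: le_lt_trans (edist_to_le y Sz) (ltry _).
Qed.

Lemma edist_to0_le S z (M : R) : S z -> enorm z <= M ->
  (edist_to 0%R S <= M%:E)%E.
Proof.
move=> Sz zM; apply: le_trans (edist_to_le _ Sz) _.
by rewrite sub0r enormN lee_fin.
Qed.

End euclidean_norm.

(** * Sequences with steps bounded by a contracting gauge *)

Section linear_descent.
Set Implicit Arguments.
Unset Strict Implicit.
Context {R : realType} {m : nat}.
Context (x : nat -> 'rV[R]_m) (D : nat -> R) (xbar : 'rV[R]_m).
Context (C r rho : R) (K0 : nat).
Context (C_ge0 : 0 <= C) (r_ge0 : 0 <= r) (r_lt1 : r < 1).
Context (D_ge0 : forall n, 0 <= D n).
Context (D_le : forall n, D n <= enorm (x n - xbar)).
Context (step : forall n, (K0 <= n)%N -> enorm (x n.+1 - x n) <= C * D n).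
Context (contraction : forall n, (K0 <= n)%N -> D n < rho ->
  enorm (x n.+1 - xbar) < rho -> D n.+1 <= r * D n).

(** The sum of the geometric series [C * r ^+ j], hence a bound on the total
length of the steps from an iterate of gauge 1, as long as the gauge contracts. *)
Let A := C / (1 - r).

(** By induction, the potential [enorm (x n - x K) + A * D n] is at most its
initial value [A * D K]: one step adds at most [C * D n] to the first term and
removes at least [A * (1 - r) * D n = C * D n] from the second.  The bound on
the potential places [x n.+1] in the ball of radius [rho], which is what allows
the contraction to be applied once more. *)
Lemma trapped_tail K : (K0 <= K)%N -> (1 + A) * enorm (x K - xbar) < rho ->
  forall n, (K <= n)%N -> D n <= D K /\ enorm (x n - x K) + A * D n <= A * D K.
Proof.
move=> K0K start.
have E : A * (1 - r) = C by rewrite mulfVK // subr_eq0 gt_eqF.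
have A0 : 0 <= A by rewrite divr_ge0 // subr_ge0 ltW.
have ADK : A * D K <= A * enorm (x K - xbar) by rewrite ler_wpM2l.
have DKe := D_le K.
elim=> [|n IHn]; first by rewrite leqn0 => /eqP ->; rewrite subrr enorm0 add0r.
rewrite leq_eqVlt => /predU1P[<-|]; first by rewrite subrr enorm0 add0r.
rewrite ltnS => Kn; have [Dn pot] := IHn Kn.
have K0n := leq_trans K0K Kn.
have dx : enorm (x n.+1 - x K) <= enorm (x n - x K) + C * D n.
  by apply: le_trans (ler_enorm_dist (x n) _ _) _; rewrite addrC lerD2l step.
have CDn : C * D n <= A * D n.
  by rewrite ler_wpM2r // -E ler_piMr // lerBlDr lerDl.
have Dr : D n.+1 <= r * D n.
  apply: contraction => //.
    have : 0 <= A * D K by rewrite mulr_ge0.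
    lra.
  have := ler_enorm_dist (x K) (x n.+1) xbar; lra.
have ADn : A * D n.+1 <= A * (r * D n) by rewrite ler_wpM2l.
split.
  by apply: le_trans Dn; apply: le_trans Dr _; rewrite ler_piMl // ltW.
by move: dx pot ADn; rewrite -E; lra.
Qed.

Context (rho_gt0 : 0 < rho).
Context (xbar_cluster : cluster (x @ \oo) xbar).

(** A single iterate close to the accumulation point traps the whole tail near
it, since [D K] is itself at most [enorm (x K - xbar)]. *)
Lemma linear_descent_cvg : x @ \oo --> xbar.
Proof.
have A0 : 0 <= A by rewrite divr_ge0 // subr_ge0 ltW.
have A1 : 0 < 1 + A by rewrite ltr_wpDr.
apply: cvg_enorm => eps eps0.
(* the trapped tail stays within (1 + A) times the initial distance *)
pose del := Num.min rho eps / (1 + A).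
have del0 : 0 < del by rewrite divr_gt0 // lt_min rho_gt0.
have tail : (x @ \oo) [set x k | k in [set k | (K0 <= k)%N]].
  by exists K0 => // k /= K0k; exists k.
have [_ [[K /= K0K <-] xK]] := xbar_cluster tail (nbhs_enorm_ball xbar del0).
have {xK} : (1 + A) * enorm (x K - xbar) < Num.min rho eps.
  by rewrite -ltr_pdivlMl // mulrC.
rewrite lt_min => /andP[start small].
exists K => // n /= Kn; have [_ pot] := trapped_tail K0K start Kn.
have := ler_enorm_dist (x K) (x n) xbar.
have : A * D K <= A * enorm (x K - xbar) by rewrite ler_wpM2l.
have : 0 <= A * D n by rewrite mulr_ge0.
lra.
Qed.

(** The trapping bound [enorm (x n - x k) <= A * D k] passes to the limit in
[n]; this turns the gauge into an upper bound for the distance to the limit. *)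
Lemma linear_descent_rate : \forall k \near \oo, enorm (x k - xbar) <= A * D k.
Proof.
have A0 : 0 <= A by rewrite divr_ge0 // subr_ge0 ltW.
have A1 : 0 < 1 + A by rewrite ltr_wpDr.
have near_xbar (eps : R) : 0 < eps ->
    \forall n \near \oo, enorm (x n - xbar) < eps.
  by move=> eps0; exact: linear_descent_cvg (nbhs_enorm_ball xbar eps0).
near=> k.
have K0k : (K0 <= k)%N by near: k; exact: nbhs_infty_ge.
have start : (1 + A) * enorm (x k - xbar) < rho.
  rewrite -ltr_pdivlMl // mulrC.
  by near: k; apply: near_xbar; exact: divr_gt0.
apply/ler_addgt0Pr => eps eps0.
have [N _ xN] := near_xbar _ eps0.
have [_ pot] := trapped_tail K0k start (leq_maxl k N).
have := ler_enorm_dist (x (maxn k N)) (x k) xbar.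
rewrite (enorm_distC (x k) (x _)).
have := xN _ (leq_maxr k N).
have : 0 <= A * D (maxn k N) by rewrite mulr_ge0.
rewrite /=; lra.
Unshelve. all: by end_near. Qed.

End linear_descent.

(** * The rate function *)

Section rate_function.
Set Implicit Arguments.
Unset Strict Implicit.
Context {R : realType}.

Lemma increasing_nneg_le (phi : R -> R) s t : increasing_nneg phi ->
  0 <= s -> s <= t -> phi s <= phi t.
Proof.
move=> phi_incr s0; rewrite le_eqVlt => /predU1P[->//|st].
exact/ltW/phi_incr.
Qed.

Context (psi beta : R -> R) (gamma b l : R).
Context (psi_incr : increasing_nneg psi) (beta_incr : increasing_nneg beta).
Context (gamma_gt0 : 0 < gamma) (b_gt0 : 0 < b) (l_gt0 : 0 < l).
Context (tau_def : rate_fun_defined psi beta gamma b l).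

Let tau := rate_fun psi beta gamma b l.

Lemma rate_fun_spec t : 0 <= t ->
  0 <= tau t /\ psi (tau t) = gamma * b * beta (l * t).
Proof.
move=> t0; have [s s0 sE] := tau_def t0.
rewrite /tau /rate_fun /inv_nneg -sE pinvKV //; last by rewrite inE.
move=> u v; rewrite !inE /nneg /= => u0 v0 uv.
by case: (ltgtP u v) => // [/(psi_incr u0)|/(psi_incr v0)]; rewrite uv ltxx.
Qed.

Lemma le_rate_fun s t : 0 <= s -> 0 <= t ->
  psi s <= gamma * b * beta (l * t) -> s <= tau t.
Proof.
move=> s0 t0; have [tau0 <-] := rate_fun_spec t0.
by apply: contraTT; rewrite -!ltNge; exact: psi_incr.
Qed.

Lemma rate_fun_le s t : 0 <= s -> s <= t -> tau s <= tau t.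
Proof.
move=> s0 st; have [tau0 tauE] := rate_fun_spec s0.
apply: le_rate_fun (le_trans s0 st) _ => //.
rewrite tauE ler_pM2l ?mulr_gt0 //; apply: increasing_nneg_le => //.
  by rewrite mulr_ge0 // ltW.
by rewrite ler_pM2l.
Qed.

Lemma rate_fun0 : psi 0 = 0 -> beta 0 = 0 -> tau 0 = 0.
Proof.
move=> psi0 beta0; have [tau0 tauE] := rate_fun_spec (lexx 0).
apply/eqP; rewrite eq_le tau0 andbT leNgt; apply/negP => /(psi_incr (lexx _)).
by rewrite tauE mulr0 beta0 mulr0 psi0 ltxx.
Qed.

End rate_function.

(** * Consequences of bounds on upper limits *)

Section limsup.
Set Implicit Arguments.
Unset Strict Implicit.
Context {R : realType}.

(** The strict inequality leaves room for a linear bound with a slope [r < 1] on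
a whole interval; the slope is taken nonnegative because the upper limit itself
may be negative or [-oo]. *)
Lemma limf_esup_quot_lt1 (g : R -> R) : g 0 = 0 ->
  (limf_esup (fun t => (g t / t)%:E) 0^'+ < 1)%E ->
  exists r, [/\ 0 <= r, r < 1 &
    exists2 del : R, 0 < del & forall t, 0 <= t -> t < del -> g t <= r * t].
Proof.
move=> g0 /ereal_inf_lt [_ [V V0 <-]] supV.
have [r [r0 r1 supr]] : exists r : R,
    [/\ 0 <= r, r < 1 & (ereal_sup [set (g t / t)%:E | t in V] <= r%:E)%E].
  case: (ereal_sup _) supV => [s||] //.
    rewrite lte_fin => s1; exists (Num.max 0 s).
    by split; rewrite ?lee_fin ?le_max ?gt_max ?lexx ?orbT // ltr01.
  by move=> _; exists 0; rewrite leNye.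
exists r; split=> //.
have [del /= del0 delV] : nbhs 0^'+ V by [].
exists del => // t; rewrite le_eqVlt => /predU1P[<- _|t0 tdel].
  by rewrite g0 mulr0.
rewrite -ler_pdivrMr // -lee_fin; apply: le_trans supr.
apply: ereal_sup_ubound; exists t => //; apply: delV => //=.
by rewrite sub0r normrN gtr0_norm.
Qed.

Lemma limn_esup_lty (u : nat -> R) (M : R) :
  (\forall k \near \oo, u k <= M) -> (limn_esup (fun k => (u k)%:E) < +oo)%E.
Proof.
move=> uM; apply: (@le_lt_trans _ _ M%:E); last exact: ltry.
apply: (@le_trans _ _ (ereal_sup [set (u k)%:E | k in [set k | u k <= M]])).
  by apply: ereal_inf_lbound; exists [set k | u k <= M].
by apply: ge_ereal_sup => _ [k /= ukM <-]; rewrite lee_fin.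
Qed.

End limsup.

(* In the last quotient 0 / 0 is read as 0; the preceding O-estimate also forces
   the numerator to vanish, for all large k, whenever the denominator does. *)
Theorem theorem4p4 (R : realType) (m : nat) (f : 'rV[R]_m -> \bar R)
    (psi beta : R -> R) (x : nat -> 'rV[R]_m) (e : nat -> R) (b : R)
    (xbar : 'rV[R]_m) (Xi : set 'rV[R]_m) (k0 : nat)
    (gamma eta l : R) (k1 : nat)
    (f_proper : proper_fun f)
    (f_lsc : lower_semicontinuous f)
    (f_bounded_below : bounded_below f)
    (psi_increasing : increasing_nneg psi) (psi_admissible : admissible psi)
    (beta_increasing : increasing_nneg beta) (beta_admissible : admissible beta)
    (e_ge0 : forall k, 0 <= e k)
    (b_gt0 : 0 < b)
    (H0 : condH0 f x) (H1 : condH1 x e) (H2 : condH2 f x e beta b)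
    (H3 : condH3 f x)
    (xbar_accumulation : cluster (x @ \oo) xbar)
    (Xi_closed : closed Xi)
    (Omega_sub_Xi : cluster (x @ \oo) `<=` Xi)
    (Xi_sub_Gamma : Xi `<=` critical_set f)
    (level_bounded : bounded_set (sublevel f (f (x k0))))
    (gamma_gt0 : 0 < gamma) (eta_gt0 : 0 < eta)
    (cond_i : forall y, enorm (y - xbar) < eta ->
      ((psi (fine (edist_to y Xi)))%:E
        <= gamma%:E * edist_to 0%R (limiting_subdiff f y))%E)
    (l_gt0 : 0 < l)
    (cond_ii : forall k, (k1 <= k)%N ->
      ((e k)%:E <= l%:E * edist_to (x k) Xi)%E)
    (tau_defined : rate_fun_defined psi beta gamma b l)
    (cond_iii :
      (limf_esup (fun t => (rate_fun psi beta gamma b l t / t)%:E) 0^'+ < 1)%E) :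
  [/\ x @ \oo --> xbar,
      Xi xbar,
      (fun k => enorm (x k.+1 - xbar) : R^o) =O_\oo
        (fun k => rate_fun psi beta gamma b l (enorm (x k - xbar)) : R^o) &
      (limn_esup (fun k => (enorm (x k.+1 - xbar)
          / rate_fun psi beta gamma b l (enorm (x k - xbar)))%:E) < +oo)%E].
Proof.
have Xi_xbar : Xi xbar := Omega_sub_Xi _ xbar_accumulation.
have [psi_ge0 psi0 _] := psi_admissible; have [_ beta0 _] := beta_admissible.
case: H1 => -[c c_gt0 x_step] _.
pose tau := rate_fun psi beta gamma b l.
pose D k := fine (edist_to (x k) Xi).
have DE k : edist_to (x k) Xi = (D k)%:E.
  by rewrite fineK // (edist_to_fin_num _ Xi_xbar).
have D_ge0 k : 0 <= D k by rewrite -lee_fin -DE edist_to_ge0.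
have D_le k : D k <= enorm (x k - xbar) by rewrite -lee_fin -DE edist_to_le.
have e_le k : (k1 <= k)%N -> e k <= l * D k.
  by move=> /cond_ii; rewrite DE -EFinM lee_fin.
have D_tau k : (k1 <= k)%N -> enorm (x k.+1 - xbar) < eta ->
    D k.+1 <= tau (D k).
  move=> k1k /cond_i; rewrite -/(D _) => psi_le.
  apply: le_rate_fun => //.
  have [w wf w_le] := H2 k.
  have /(lee_wpmul2l _) : (edist_to 0%R (limiting_subdiff f (x k.+1)) <=
      (b * beta (l * D k))%:E)%E.
    apply: edist_to0_le wf _; apply: le_trans w_le _.
    rewrite ler_pM2l //; apply: increasing_nneg_le => //; exact: e_le.
  move=> /(_ gamma%:E); rewrite lee_fin => /(_ (ltW gamma_gt0)).
  by move=> /(le_trans psi_le); rewrite -EFinM lee_fin mulrA.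
have tau0 : tau 0 = 0 by exact: rate_fun0.
have [r [r_ge0 r_lt1 [del del_gt0 tau_le]]] := limf_esup_quot_lt1 tau0 cond_iii.
pose rho := Num.min eta del.
have rho_gt0 : 0 < rho by rewrite lt_min eta_gt0.
have step k : (k1 <= k)%N -> enorm (x k.+1 - x k) <= c * l * D k.
  by move=> k1k; apply: le_trans (x_step k) _; rewrite -mulrA ler_pM2l // e_le.
have contraction k : (k1 <= k)%N -> D k < rho ->
    enorm (x k.+1 - xbar) < rho -> D k.+1 <= r * D k.
  move=> k1k; rewrite !lt_min => /andP[_ Dk] /andP[xk _].
  by apply: le_trans (D_tau _ k1k xk) _; exact: tau_le.
have cl_ge0 : 0 <= c * l by rewrite ltW // mulr_gt0.
have x_cvg : x @ \oo --> xbar.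
  exact: (linear_descent_cvg cl_ge0 r_ge0 r_lt1 D_ge0 D_le step contraction).
set A := c * l / (1 - r).
have A_ge0 : 0 <= A by rewrite divr_ge0 // subr_ge0 ltW.
have tau_ge0 k : 0 <= tau (enorm (x k - xbar)).
  have xk_ge0 := enorm_ge0 (x k - xbar).
  by have [] := rate_fun_spec psi_increasing tau_defined xk_ge0.
have rate : \forall k \near \oo,
    enorm (x k.+1 - xbar) <= A * tau (enorm (x k - xbar)).
  have [N _ xN] := linear_descent_rate cl_ge0 r_ge0 r_lt1 D_ge0 D_le step
    contraction rho_gt0 xbar_accumulation.
  have [N' _ xN'] := x_cvg _ (nbhs_enorm_ball xbar eta_gt0).
  exists (maxn k1 (maxn N N')) => // k /=.
  rewrite !geq_max => /and3P[k1k Nk N'k].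
  apply: le_trans (xN k.+1 (leqW Nk)) _; rewrite ler_wpM2l //.
  apply: le_trans (D_tau _ k1k (xN' k.+1 (leqW N'k))) _.
  exact: rate_fun_le.
split=> //.
- apply/eqO_exP; exists (A + 1); first by rewrite ltr_wpDl.
  near=> k; rewrite !ger0_norm ?enorm_ge0 //.
  apply: (@le_trans _ _ (A * tau (enorm (x k - xbar)))); first by near: k.
  by rewrite ler_wpM2r // lerDl.
- apply: (@limn_esup_lty _ _ A); near=> k.
  have := tau_ge0 k; rewrite le_eqVlt => /predU1P[t0|t0].
      by rewrite -/tau -t0 invr0 mulr0.
  by rewrite -/tau ler_pdivrMr //; near: k.
Unshelve. all: by end_near.
Qed.
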